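(* For every positive integer $n$ there exist a $4$-dense $n$-element point set $P_n$ in the plane and a stacking order $f$ of $\mathcal{D}(P_n)$ such that $$\lim_{\varepsilon\to 0}\mathrm{vis}(\mathcal{D}(\varepsilon P_n),f)\ge n^{3/4},$$ where $f$ also denotes the corresponding stacking order of $\mathcal{D}(\varepsilon P_n)$.
   Context: For a point $p$ in the plane, $D(p)$ denotes the closed disk of radius $1$ centered at $p$, and for a finite point set $P$, $\mathcal{D}(P)=\{D(p): p\in P\}$. A stacking order of a finite collection $\mathcal{D}$ of $n$ distinct unit disks is a bijection $f:\mathcal{D}\to\{1,\dots,n\}$; $f(D)$ is regarded as the height of $D$, and the arrangement is viewed from below. A point $x$ on the boundary circle of $D\in\mathcal{D}$ is visible if $x$ does not lie in any disk $D'\in\mathcal{D}$ with $f(D')<f(D)$. The visible perimeter $\mathrm{vis}(\mathcal{D},f)$ is the total length of all visible boundary points, summed over all disks of $\mathcal{D}$. For $\varepsilon>0$, $\varepsilon P=\{(\varepsilon x,\varepsilon y): (x,y)\in P\}$, and a stacking order $f$ of $\mathcal{D}(P)$ is identified with the stacking order $D(\varepsilon p)\mapsto f(D(p))$ of $\mathcal{D}(\varepsilon P)$. An $n$-element point set $P$ is $C$-dense if $\max\{|pq|: p,q\in P\}\,/\,\min\{|pq|: p,q\in P,\ p\ne q\}\le C n^{1/2}$. *)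

(* Defs.v *)
From HB Require Import structures.
From mathcomp Require Import all_boot all_order all_algebra.
From mathcomp Require Import all_classical all_reals all_analysis.
Set Implicit Arguments. Unset Strict Implicit. Unset Printing Implicit Defensive.
Import Order.TTheory GRing.Theory Num.Theory numFieldNormedType.Exports.
Local Open Scope classical_set_scope.
Local Open Scope ring_scope.

Section Defs.
Variable R : realType.
Definition pt2 := (R * R)%type.

Definition pdist (p q : pt2) : R :=
  Num.sqrt ((p.1 - q.1) ^+ 2 + (p.2 - q.2) ^+ 2).

Definition in_disk (c x : pt2) : Prop := pdist c x <= 1.

Definition circ (c : pt2) (t : R) : pt2 := (c.1 + cos t, c.2 + sin t).

Definition scale (e : R) (p : pt2) : pt2 := (e * p.1, e * p.2).

(* f : pt2 -> nat is a stacking order of D(P) (P given as a duplicate-free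
   list of centres): a bijection from P onto {1,..,|P|}. *)
Definition stacking_order (P : seq pt2) (f : pt2 -> nat) : Prop :=
  {in P &, injective f} /\ (forall p, p \in P -> (1 <= f p <= size P)%N).

(* visible boundary points of D(p): arc-length measure of the visible part,
   parametrised by the angle t in [0, 2 pi) (unit radius, so angle = length). *)
Definition visible_arc (P : seq pt2) (f : pt2 -> nat) (p : pt2) : set R :=
  [set t | 0 <= t < 2 * pi /\
           forall q, q \in P -> (f q < f p)%N -> ~ in_disk q (circ p t)].

Definition vis (P : seq pt2) (f : pt2 -> nat) : R :=
  fine (\sum_(p <- P) (@lebesgue_measure R) (visible_arc P f p))%E.

(* C-C_dense: max distance <= C n^{1/2} * min distance (vacuous for n = 1) *)
Definition C_dense (C : R) (P : seq pt2) : Prop :=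
  forall p q p' q', p \in P -> q \in P -> p' \in P -> q' \in P -> p' != q' ->
    pdist p q <= C * Num.sqrt (size P)%:R * pdist p' q'.
End Defs.

(* Main.v *)
Require Import Defs.
From HB Require Import structures.
From mathcomp Require Import all_boot all_order all_algebra.
From mathcomp Require Import all_classical all_reals all_analysis.
From mathcomp Require Import ring lra zify.
Import Order.TTheory GRing.Theory Num.Theory numFieldNormedType.Exports.
Local Open Scope classical_set_scope.
Local Open Scope ring_scope.

(** As the scale tends to 0, the visible part of D(p) shrinks to the set of
    directions in which p is extreme among itself and the centres below it.

    Let J be the integer part of n^(1/4).  Take a concave chain of J (J + 1)
    points with abscissas 0, 1, 2, ..., made of J runs of J + 1 collinear points
    whose slopes decrease in steps of 2 / J within [-1, 1].  Stack vertical
    translates of the chain by 2 on top of each other, and order the points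
    layer by layer and from left to right in each layer.  In a direction whose
    cotangent lies between the slopes of a run and of the next one (up to sign),
    each point of the run beats the points to its left; the points to its right
    exceed it by at most J * (2 / J) = 2, which is the distance between layers,
    so those of the lower layers do not hide it.  Hence each of the n points
    sees an angle of at least 1 / J >= n^(-1/4). *)

(** * Visible arcs at scale [e] and the limit of the perimeter *)

(** The squared distance from [scale e q] to the boundary point is [1 + e * d], where [d] is affine
    in [e] and tends to twice the scalar product of [p - q] with the direction [t]. *)
Lemma notin_disk_scaleE (R : realType) (e : R) (p q : pt2 R) (t : R) :
  0 < e ->
  ~ in_disk (scale e q) (circ (scale e p) t) <->
  0 < 2 * ((p.1 - q.1) * cos t + (p.2 - q.2) * sin t) +
      e * ((p.1 - q.1) ^+ 2 + (p.2 - q.2) ^+ 2).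
Proof.
move=> e0; rewrite /in_disk /pdist /circ /scale /=.
set d := 2 * _ + _.
have -> : (e * q.1 - (e * p.1 + cos t)) ^+ 2 +
    (e * q.2 - (e * p.2 + sin t)) ^+ 2 = 1 + e * d.
  by rewrite -(cos2Dsin2 t) /d; ring.
split=> [/negP|d0]; last apply/negP; rewrite -ltNge.
  move=> h; rewrite -(pmulr_rgt0 _ e0) -(ltrD2l 1) addr0 ltNge.
  by apply: contraTN h => h; rewrite -leNgt -[leRHS]sqrtr1 ler_wsqrtr.
by rewrite -[ltLHS]sqrtr1 ltr_sqrt ?ltrDl ?mulr_gt0// addr_gt0// mulr_gt0.
Qed.

Lemma measurable_forall_seq (R : realType) (T : eqType) (s : seq T)
    (A : T -> set R) :
  (forall q, measurable (A q)) ->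
  measurable [set t | forall q, q \in s -> A q t].
Proof.
move=> mA; elim: s => [|x s ih].
  rewrite (_ : [set _ | _] = setT); first exact: measurableT.
  by apply/seteqP; split.
rewrite (_ : [set _ | _] = A x `&` [set t | forall q, q \in s -> A q t]).
  exact: measurableI.
apply/seteqP; split=> [t h|t [Ax h] q].
  by split=> [|q qs]; apply: h; rewrite inE ?eqxx// qs orbT.
by rewrite inE => /orP[/eqP->|/h].
Qed.

Lemma measurable_visible_arc (R : realType) (P : seq (pt2 R))
    (f : pt2 R -> nat) (p : pt2 R) :
  measurable (visible_arc P f p).
Proof.
rewrite (_ : visible_arc P f p = `[0, 2 * pi[ `&` [set t |
    forall q, q \in [seq q <- P | (f q < f p)%N] -> ~ in_disk q (circ p t)]).
  apply: measurableI => //.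
  apply: (@measurable_forall_seq R _ _ (fun q t => ~ in_disk q (circ p t))) => q.
  (* At scale 1 the condition is positivity of a continuous function of [t], hence open. *)
  rewrite [X in measurable X](_ : _ =
      (fun t => 2 * ((p.1 - q.1) * cos t + (p.2 - q.2) * sin t) +
      1 * ((p.1 - q.1) ^+ 2 + (p.2 - q.2) ^+ 2)) @^-1` [set x | 0 < x]); last first.
    apply/seteqP; split=> t /=; rewrite -(@notin_disk_scaleE R 1)// /scale;
    by rewrite !mul1r -!surjective_pairing.
  apply: measurable_realfun.open_measurable; apply: open_comp; last exact: open_gt.
  move=> t _; apply: cvgD; last exact: cvg_cst.
  apply: cvgM; first exact: cvg_cst.
  by apply: cvgD; apply: cvgM; try exact: cvg_cst;
    [exact: continuous_cos|exact: continuous_sin].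
apply/seteqP; split=> t /=; rewrite /visible_arc /= in_itv/= => -[t0 h];
  split=> // q.
  by rewrite mem_filter => /andP[fq qP]; exact: h.
by move=> qP fq; apply: h; rewrite mem_filter fq.
Qed.

Lemma visible_arc_fin_num (R : realType) (P : seq (pt2 R))
    (f : pt2 R -> nat) (p : pt2 R) :
  lebesgue_measure (visible_arc P f p) \is a fin_num.
Proof.
rewrite ge0_fin_numE// (@le_lt_trans _ _ (lebesgue_measure `[0%R, 2 * (pi : R)[))//.
  apply: le_measure; rewrite ?inE//; first exact: measurable_visible_arc.
  by move=> t [t0 _]; rewrite /= in_itv.
by rewrite lebesgue_measure_itv/=; case: ifP => _; rewrite ?ltry.
Qed.

Lemma visE (R : realType) (P : seq (pt2 R)) (f : pt2 R -> nat) :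
  vis P f = \sum_(p <- P) fine (lebesgue_measure (visible_arc P f p)).
Proof.
by rewrite /vis sum_fine// => p _; exact: visible_arc_fin_num.
Qed.

Lemma scaleK (R : realType) (e : R) : e != 0 -> cancel (scale e) (scale e^-1).
Proof. by move=> e0 [x y]; rewrite /scale /= !mulKf. Qed.

Lemma visible_arc_scaleE (R : realType) (P : seq (pt2 R)) (f : pt2 R -> nat)
    (e : R) (p : pt2 R) (t : R) : 0 < e ->
  visible_arc (map (scale e) P) (fun x => f (scale e^-1 x)) (scale e p) t <->
  0 <= t < 2 * pi /\ (forall q, q \in P -> (f q < f p)%N ->
    0 < 2 * ((p.1 - q.1) * cos t + (p.2 - q.2) * sin t) +
        e * ((p.1 - q.1) ^+ 2 + (p.2 - q.2) ^+ 2)).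
Proof.
move=> e0; have e1 : e != 0 by rewrite gt_eqF.
rewrite /visible_arc /=; split=> -[t0 h]; split=> // q.
  move=> qP fq; apply/notin_disk_scaleE => //; apply: h; first exact: map_f.
  by rewrite !scaleK.
by move=> /mapP[q' qP ->]; rewrite !scaleK// => fq; apply/notin_disk_scaleE/h.
Qed.

(** The coefficient of [e] in the visibility condition is a squared distance, so every arc shrinks
    as [e] decreases. *)
Lemma le_vis_scale (R : realType) (P : seq (pt2 R)) (f : pt2 R -> nat)
    (e e' : R) : 0 < e -> e <= e' ->
  vis (map (scale e) P) (fun x => f (scale e^-1 x)) <=
  vis (map (scale e') P) (fun x => f (scale e'^-1 x)).
Proof.
move=> e0 ee'; have e'0 := lt_le_trans e0 ee'.
rewrite !visE !big_map; apply: ler_sum => p _.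
apply: fine_le; try exact: visible_arc_fin_num.
apply: le_measure; rewrite ?inE; try exact: measurable_visible_arc.
move=> t /visible_arc_scaleE -/(_ e0)[t0 h].
apply/visible_arc_scaleE => //; split=> // q qP fq.
apply: (lt_le_trans (h q qP fq)); rewrite lerD2l ler_wpM2r//.
by rewrite addr_ge0// sqr_ge0.
Qed.

(* In the limit the visible arc of D(p) is the cone of outer normals, at p, of
   the convex hull of p and the centres below it; and vis decreases with the
   scale, so that its limit is bounded below by the angles of these cones. *)
Lemma vis_limit_ge (R : realType) (P : seq (pt2 R)) (f : pt2 R -> nat) (c : R) :
  0 <= c ->
  (forall p, p \in P -> exists a b : R,
    [/\ 0 <= a, b < 2 * pi, c <= b - a &
        forall t, a <= t <= b -> forall q, q \in P -> (f q < f p)%N ->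
          0 <= (p.1 - q.1) * cos t + (p.2 - q.2) * sin t]) ->
  exists L : R,
    (fun e : R => vis (map (scale e) P) (fun x => f (scale e^-1 x)))
      @ 0^'+ --> L /\ (size P)%:R * c <= L.
Proof.
move=> c0 hP.
pose V e := vis (map (scale e) P) (fun x => f (scale e^-1 x)).
have lbV e : 0 < e -> (size P)%:R * c <= V e.
  move=> e0; rewrite /V visE big_map mulr_natl.
  rewrite -count_predT -iter_addr_0 -big_const_seq.
  rewrite big_seq [leRHS]big_seq; apply: ler_sum => p pP.
  have [a [b [a0 b2 cab h]]] := hP p pP.
  rewrite -lee_fin fineK; last exact: visible_arc_fin_num.
  apply: (@le_trans _ _ (lebesgue_measure `[a, b])).
    rewrite lebesgue_measure_itv/= lte_fin; case: ltP => [_|ba].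
      by rewrite -EFinB lee_fin.
    by rewrite lee_fin; lra.
  apply: le_measure; rewrite ?inE//; first exact: measurable_visible_arc.
  move=> t; rewrite /= in_itv/= => tab; apply/visible_arc_scaleE => //.
  split=> [|q qP fq]; first lra.
  (* A strictly lower [q] differs from [p], so the term in [e] makes the weak inequality of the cone
     strict at every scale. *)
  have pq : 0 < (p.1 - q.1) ^+ 2 + (p.2 - q.2) ^+ 2.
    rewrite lt_def addr_ge0 ?sqr_ge0// andbT paddr_eq0 ?sqr_ge0//.
    rewrite !sqrf_eq0 !subr_eq0; apply: contraTN fq => /andP[/eqP h1 /eqP h2].
    by rewrite [p]surjective_pairing h1 h2 -surjective_pairing ltnn.
  by rewrite ltr_wpDl ?mulr_gt0// mulr_ge0// h.
exists (inf (V @` [set` `]0, +oo[])); split.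
  apply: nondecreasing_at_right_cvgr => //.
    by move=> e e'; rewrite !in_itv/= !andbT => e0 _; exact: le_vis_scale.
  by exists ((size P)%:R * c) => _ [e + <-]; rewrite /= in_itv/= andbT; exact: lbV.
apply: lb_le_inf.
  by exists (V 1), 1 => //=; rewrite in_itv/= ltr01.
by move=> _ [e + <-]; rewrite /= in_itv/= andbT; exact: lbV.
Qed.

(** * The layered concave chains *)

(** The opposite of the slope of the [j]-th run, that is, the cotangent of its upward normal; hence
    increasing in [j]. *)
Definition slope (R : realType) (J j : nat) : R := -1 + 2 * (j%:R / J%:R).

(* Concave: J runs of J.+1 consecutive integers, with decrement [slope R J j]
   on the steps into the points of the j-th run. *)
Definition profile (R : realType) (J x : nat) : R :=
  - \sum_(y < x) slope R J (y.+1 %/ J.+1).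

(** Quotient and remainder are layer and position, so increasing [i] is the stacking order; the top
    layer may be incomplete. *)
Definition layered_pt (R : realType) (J i : nat) : pt2 R :=
  ((i %% (J * J.+1))%:R,
   2 * (i %/ (J * J.+1))%:R + profile R J (i %% (J * J.+1))).

Lemma slope_le (R : realType) (J j j' : nat) :
  (j <= j')%N -> slope R J j <= slope R J j'.
Proof.
by move=> jj'; rewrite lerD2l ler_pM2l// ler_wpM2r ?invr_ge0// ler_nat.
Qed.

Lemma slopeS (R : realType) (J j : nat) :
  slope R J j.+1 = slope R J j + 2 / J%:R.
Proof. by rewrite /slope -natr1; ring. Qed.

Lemma slope_bounds (R : realType) (J j : nat) :
  (j <= J)%N -> -1 <= slope R J j <= 1.
Proof.
move=> jJ; rewrite /slope.
have h0 : 0 <= j%:R / J%:R :> R by rewrite divr_ge0.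
have h1 : j%:R / J%:R <= 1 :> R.
  case: J jJ {h0} => [|J] jJ; first by rewrite invr0 mulr0.
  by rewrite ler_pdivrMr ?ltr0n// mul1r ler_nat.
lra.
Qed.

Lemma profileS (R : realType) (J x : nat) :
  profile R J x.+1 = profile R J x - slope R J (x.+1 %/ J.+1).
Proof. by rewrite /profile big_ord_recr/= opprD. Qed.

(** Within the chain all steps have slopes in [-1, 1]; this controls the height of a layer. *)
Lemma profile_dist (R : realType) (J x y : nat) :
  (x < J * J.+1)%N -> (y <= x)%N ->
  `|profile R J x - profile R J y| <= x%:R - y%:R.
Proof.
elim: x => [|x ih] xM; first by rewrite leqn0 => /eqP->; rewrite !subrr normr0.
rewrite leq_eqVlt => /orP[/eqP->|yx]; first by rewrite !subrr normr0.
have {}ih := ih (ltnW xM) yx.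
have jJ : (x.+1 %/ J.+1 <= J)%N by rewrite ltnW// ltn_divLR.
have /andP[h1 h2] := slope_bounds R _ _ jJ.
move: ih; rewrite profileS -natr1 !ler_norml => /andP[h3 h4].
by apply/andP; split; lra.
Qed.

(** Each step left of [x] adds [s] minus a decrement that is at most [s]. *)
Lemma profile_tilt_left (R : realType) (J x x' : nat) (s : R) :
  (x' <= x)%N -> slope R J (x %/ J.+1) <= s ->
  profile R J x' + s * x'%:R <= profile R J x + s * x%:R.
Proof.
elim: x => [|x ih]; first by rewrite leqn0 => /eqP->.
rewrite leq_eqVlt => /orP[/eqP->//|xx] hs.
apply: (le_trans (ih xx _)).
  by apply: le_trans hs; exact/slope_le/leq_div2r.
by rewrite profileS -natr1; lra.
Qed.

(* Past x the tilted profile keeps rising, by at most 2 / J per step, only up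
   to the end of the run of x, that is for at most J steps. *)
Lemma profile_tilt_right (R : realType) (J x x' : nat) (s : R) :
  (0 < J)%N -> (x <= x')%N ->
  slope R J (x %/ J.+1) <= s <= slope R J (x %/ J.+1).+1 ->
  profile R J x' + s * x'%:R <= profile R J x + s * x%:R + 2.
Proof.
(* [e] is the last abscissa of the run of [x], so [e - x <= J]; the [minn] below stops counting
   gains there. *)
move=> J0 xx' /andP[s1 s2]; set e := (x %/ J.+1 * J.+1 + J)%N.
have J0' : 0 < J%:R :> R by rewrite ltr0n.
have xe : (x <= e)%N by rewrite {1}(divn_eq x J.+1) leq_add2l -ltnS ltn_mod.
suff h : profile R J x' + s * x'%:R <=
    profile R J x + s * x%:R + 2 / J%:R * (minn x' e - x)%:R.
  apply: (le_trans h); rewrite lerD2l -mulrA ger_pMr// ler_pdivrMl// mulr1.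
  rewrite ler_nat; have := leq_trunc_div x J.+1; have := geq_minr x' e.
  by rewrite {2}/e; lia.
elim: x' xx' => [|x' ih].
  by rewrite leqn0 => /eqP->; rewrite lerDl mulr_ge0// divr_ge0.
rewrite leq_eqVlt => /orP[/eqP<-|xx].
  by rewrite lerDl mulr_ge0// divr_ge0.
have {}ih := ih xx; rewrite profileS -natr1.
have [xe'|ex'] := leqP x'.+1 e.
  have hj : slope R J (x %/ J.+1) <= slope R J (x'.+1 %/ J.+1).
    exact/slope_le/leq_div2r/ltnW.
  move: ih s2; rewrite (minn_idPl (ltnW xe')) subSn//.
  by rewrite slopeS -natr1; lra.
(* Beyond [e] the decrement is at least [s], so nothing more is gained. *)
have hj : slope R J (x %/ J.+1).+1 <= slope R J (x'.+1 %/ J.+1).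
  by apply: slope_le; rewrite leq_divRL// mulSn addnC addnS.
by move: ih; rewrite (minn_idPr _)//; lra.
Qed.

(** * Directions and their cotangents *)

(** The derivative [1 / (1 + c ^+ 2)] is at least 1/2 on [-1, 1]. *)
Lemma atanB_ge (R : realType) (a b : R) :
  -1 <= a -> a <= b -> b <= 1 -> (b - a) / 2 <= atan b - atan a.
Proof.
move=> a1 ab b1.
have [c + ->] := MVT_segment ab (fun x _ => is_derive1_atan x)
  (continuous_subspaceT (@continuous_atan R)).
rewrite in_itv/= => /andP[ac cb].
rewrite mulrC ler_wpM2r ?subr_ge0//.
rewrite lef_pV2 ?posrE//; last by rewrite ltr_wpDr// sqr_ge0.
have c2 : c ^+ 2 <= 1 by nra.
by lra.
Qed.

(** The witness [s] is the cotangent of [t], obtained as the tangent of [pi / 2 - t]. *)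
Lemma cot_bounds (R : realType) (a b t : R) :
  pi / 2 - atan b <= t <= pi / 2 - atan a ->
  0 < sin t /\ exists2 s, a <= s <= b & cos t = s * sin t.
Proof.
move=> /andP[bt ta].
have ha := atan_gtNpi2 a; have hb := atan_ltpi2 b.
pose u := pi / 2 - t.
have uI : - (pi / 2) < u < pi / 2 by rewrite /u; apply/andP; split; lra.
have cu := cos_gt0_pihalf uI.
have tE : t = - (u - pi / 2) by rewrite /u; ring.
have sE : sin t = cos u by rewrite tE sinN sinBpihalf opprK.
have cE : cos t = sin u by rewrite tE cosN cosBpihalf.
split; first by rewrite sE.
exists (tan u); last by rewrite sE cE /tan divfK// gt_eqF.
have uK : atan (tan u) = u by apply: tanK; rewrite in_itv/=.
apply/andP; split; rewrite leNgt; apply/negP => /lt_atan; rewrite uK /u; lra.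
Qed.

(** * Separation and diameter *)

Lemma pdistC (R : realType) (p q : pt2 R) : pdist p q = pdist q p.
Proof. by rewrite /pdist -sqrrN opprB -[X in _ + X]sqrrN opprB. Qed.

Lemma sqr_natrB_ge1 (R : realType) (a b : nat) :
  a != b -> 1 <= (a%:R - b%:R) ^+ 2 :> R.
Proof.
wlog ab : a b / (a <= b)%N => [hw|].
  by case: (leqP a b) => [/hw//|/ltnW /hw h]; rewrite eq_sym -sqrrN opprB.
rewrite neq_ltn [(b < a)%N]ltnNge ab orbF => {}ab.
by rewrite -sqrrN opprB -natrB 1?ltnW// -natrX ler1n expn_gt0 subn_gt0 ab//.
Qed.

(** Distinct abscissas are integers; on a common abscissa, layers are 2 apart. *)
Lemma layered_pt_separated (R : realType) (J i i' : nat) :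
  i != i' -> 1 <= pdist (layered_pt R J i) (layered_pt R J i').
Proof.
move=> ii'; rewrite /pdist -[leLHS]sqrtr1 ler_wsqrtr// /layered_pt /=.
set M := (J * J.+1)%N.
have [xx|xx] := eqVneq (i %% M)%N (i' %% M)%N; last first.
  by rewrite ler_wpDr ?sqr_ge0// sqr_natrB_ge1.
have kk : (i %/ M)%N != (i' %/ M)%N.
  apply: contraNneq ii' => kk.
  by rewrite (divn_eq i M) (divn_eq i' M) kk xx.
have := @sqr_natrB_ge1 R _ _ kk.
rewrite xx; set u := _%:R; set v := (i' %/ M)%:R; nra.
Qed.

(* [k] bounds the difference of the layers of two among the first [n] points. *)
Lemma layered_diam_ineq (R : realType) (m k n : R) :
  1 <= m -> 0 <= k -> m ^+ 4 <= n -> n <= (m + 1) ^+ 4 - 1 ->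
  k * (m * (m + 1)) <= n - 1 ->
  (m * (m + 1) - 1) ^+ 2 + (2 * k + (m * (m + 1) - 1)) ^+ 2 <= 16 * n.
Proof.
move=> m1 k0 mn nm kn; set M := m * (m + 1) in kn *.
have M0 : 0 < M by rewrite /M; nra.
have M1 : 0 <= M - 1 by rewrite /M; nra.
(* In terms of [z] the polynomials below have nonnegative coefficients. *)
pose z := m - 1; have mE : m = 1 + z by rewrite /z; ring.
have z0 : 0 <= z by rewrite /z subr_ge0.
set T := (m + 1) ^+ 4 - 2.
have kT : k * M <= T by rewrite /T; lra.
have kM0 : 0 <= k * M by rewrite mulr_ge0// ltW.
(* After multiplication by [M ^+ 2], bounding [k * M] by [n - 1] and once by [T] leaves an
   inequality affine in [n]: [C0] is the sign of its slope, [F0] its value at [n = m ^+ 4]. *)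
have C0 : 0 <= 12 * M ^+ 2 + 4 * M - 4 * T.
  have -> : 12 * M ^+ 2 + 4 * M - 4 * T =
      z * (28 + z * (64 + z * (40 + z * 8))) by rewrite /M /T mE; ring.
  by repeat first [exact: z0 | apply: mulr_ge0 | apply: addr_ge0 | by []].
have F0 : 0 <= (m ^+ 4 - 1) * (12 * M ^+ 2 + 4 * M - 4 * T) + 16 * M ^+ 2 -
    2 * (M * (M - 1)) ^+ 2.
  have -> : (m ^+ 4 - 1) * (12 * M ^+ 2 + 4 * M - 4 * T) + 16 * M ^+ 2 -
      2 * (M * (M - 1)) ^+ 2 = 56 + z * (120 + z * (62 + z * (40 + z * (160 +
      z * (232 + z * (152 + z * (48 + z * 6))))))) by rewrite /M /T mE; ring.
  by repeat first [exact: z0 | apply: mulr_ge0 | apply: addr_ge0 | by []].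
have h1 : (k * M) ^+ 2 <= (n - 1) * T.
  by rewrite expr2 ler_pM.
have h2 : k * M * (M * (M - 1)) <= (n - 1) * (M * (M - 1)).
  by rewrite ler_wpM2r// mulr_ge0// ltW.
have h3 : (m ^+ 4 - 1) * (12 * M ^+ 2 + 4 * M - 4 * T) <=
    (n - 1) * (12 * M ^+ 2 + 4 * M - 4 * T).
  by rewrite ler_wpM2r// lerD2r.
have M2 : 0 < M ^+ 2 by rewrite exprn_gt0.
rewrite -(ler_pM2r M2).
have -> : ((M - 1) ^+ 2 + (2 * k + (M - 1)) ^+ 2) * M ^+ 2 =
  2 * (M * (M - 1)) ^+ 2 + 4 * (k * M * (M * (M - 1))) + 4 * (k * M) ^+ 2 by ring.
lra.
Qed.

(** With [M] points per full layer and layers differing by at most [d], the coordinates differ by at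
    most [M - 1] and [2 * d + (M - 1)]. *)
Lemma layered_pt_diam (R : realType) (J n i i' : nat) :
  (0 < J)%N -> (J ^ 4 <= n < J.+1 ^ 4)%N -> (i < n)%N -> (i' < n)%N ->
  pdist (layered_pt R J i) (layered_pt R J i') <= 4 * Num.sqrt n%:R.
Proof.
move=> J0 /andP[Jn nJ] i_n i'_n.
have J1 : 1 <= J%:R :> R by rewrite ler1n.
pose M := (J * J.+1)%N.
have M0 : (0 < M)%N by rewrite muln_gt0 J0.
have ME : M%:R = J%:R * (J%:R + 1) :> R by rewrite natrM -natr1.
wlog xx : i i' i_n i'_n / (i' %% M <= i %% M)%N => [hw|].
  have [xx|/ltnW xx] := leqP (i' %% M) (i %% M); first exact: hw.
  by rewrite pdistC; exact: hw.
rewrite /pdist /layered_pt /= -/M.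
have xM : (i %% M < M)%N by rewrite ltn_mod.
have := @profile_dist R J _ _ xM xx.
set g := profile R J _; set g' := profile R J _.
have xd : (i %% M)%:R - (i' %% M)%:R <= M%:R - 1 :> R.
  have : (i %% M)%:R <= M.-1%:R :> R by rewrite ler_nat -ltnS prednK.
  have : 0 <= (i' %% M)%:R :> R by [].
  by rewrite -[in M%:R - 1](prednK M0) -natr1; lra.
have xd0 : 0 <= (i %% M)%:R - (i' %% M)%:R :> R by rewrite subr_ge0 ler_nat.
set dx := _ - (i' %% M)%:R in xd xd0 *.
rewrite ler_norml => /andP[g1 g2].
(* [d] is the larger of the two layer numbers. *)
have [d [dn d1 d2]] : exists d : R, [/\ d * M%:R <= n%:R - 1,
    (i %/ M)%:R - (i' %/ M)%:R <= d & (i' %/ M)%:R - (i %/ M)%:R <= d].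
  have hd l : (l < n)%N -> (l %/ M)%:R * M%:R <= n%:R - 1 :> R.
    move=> ln; rewrite -natrM lerBrDr natr1 ler_nat.
    by apply: leq_ltn_trans ln; exact: leq_trunc_div.
  have k0 : 0 <= (i %/ M)%:R :> R by [].
  have k0' : 0 <= (i' %/ M)%:R :> R by [].
  have [h|h] := lerP ((i %/ M)%:R : R) (i' %/ M)%:R.
    by exists (i' %/ M)%:R; split; [exact: hd|lra|lra].
  by exists (i %/ M)%:R; split; [exact: hd|lra|lra].
have d0 : 0 <= d by lra.
have h := @layered_diam_ineq R J%:R d n%:R J1 d0.
have -> : 4 * Num.sqrt n%:R = Num.sqrt (16 * n%:R) :> R.
  have -> : 16 = 4 ^+ 2 :> R by ring.
  by rewrite sqrtrM ?sqr_ge0// sqrtr_sqr ger0_norm.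
rewrite ler_wsqrtr//; apply: le_trans (h _ _ _).
- rewrite -ME; apply: lerD.
    by rewrite ler_sqr ?nnegrE//; lra.
  rewrite -ler_sqrt ?sqr_ge0// !sqrtr_sqr.
  by rewrite [leRHS]ger0_norm ?ler_norml; [apply/andP; split|]; lra.
- by rewrite -natrX ler_nat.
- by rewrite natr1 -natrX lerBrDr natr1 ler_nat.
- by rewrite -ME.
Qed.

(** * Extreme directions and the choice of parameters *)

(** Dividing by [sin t > 0] compares heights tilted by the cotangent [s]. A lower point further
    right lies in a strictly lower layer, and the gap 2 absorbs its possible gain. *)
Lemma layered_pt_extreme (R : realType) (J i i' : nat) (t : R) :
  (0 < J)%N -> (i' < i)%N ->
  let j := (i %% (J * J.+1) %/ J.+1)%N in
  let p := layered_pt R J i in let q := layered_pt R J i' in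
  pi / 2 - atan (slope R J j.+1) <= t <= pi / 2 - atan (slope R J j) ->
  0 <= (p.1 - q.1) * cos t + (p.2 - q.2) * sin t.
Proof.
move=> J0 ii' /= /cot_bounds[st [s hs ->]].
set M := (J * J.+1)%N in hs *; set x := (i %% M)%N; set x' := (i' %% M)%N.
rewrite mulrA -mulrDl mulr_ge0 ?(ltW st)//.
suff : 2 * (i' %/ M)%:R + (profile R J x' + s * x'%:R) <=
    2 * (i %/ M)%:R + (profile R J x + s * x%:R) by lra.
have [xx|xx] := leqP x' x.
  have kk : (i' %/ M)%:R <= (i %/ M)%:R :> R by rewrite ler_nat leq_div2r// ltnW.
  have /andP[hs1 _] := hs.
  by have := @profile_tilt_left R J _ _ s xx hs1; lra.
have kk : (i' %/ M)%:R + 1 <= (i %/ M)%:R :> R.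
  rewrite natr1 ler_nat ltnNge; apply/negP => kk.
  move: ii'; rewrite (divn_eq i M) (divn_eq i' M) ltnNge leq_add ?(ltnW xx)//.
  by rewrite leq_mul2r kk orbT.
by have := @profile_tilt_right R J _ _ s J0 (ltnW xx) hs; lra.
Qed.

Lemma exists_nat_root (k n : nat) :
  (0 < k)%N -> exists J : nat, (J ^ k <= n < J.+1 ^ k)%N.
Proof.
move=> k0; elim: n => [|n [J /andP[Jn nJ]]].
  by exists 0%N; rewrite exp0n// exp1n.
have [h|h] := ltnP n.+1 (J.+1 ^ k); first by exists J; rewrite h ltnW.
by exists J.+1; rewrite h (leq_ltn_trans nJ)// ltn_exp2r.
Qed.

(** [J] is at most the fourth root of [n], and the powers 3/4 and 1/4 of [n] multiply to [n]. *)
Lemma powR34_le (R : realType) (J n : nat) :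
  (0 < J)%N -> (J ^ 4 <= n)%N -> n%:R `^ (3 / 4) <= n%:R * (J%:R)^-1 :> R.
Proof.
move=> J0 Jn; have n0 : (0 < n)%N by apply: leq_trans Jn; rewrite expn_gt0 J0.
rewrite ler_pdivlMr ?ltr0n//.
have nE : n%:R `^ (3 / 4) * n%:R `^ (1 / 4) = n%:R :> R.
  rewrite -powRD; last by rewrite pnatr_eq0 gtn_eqF// implybT.
  have -> : 3 / 4 + 1 / 4 = 1 :> R by field.
  by rewrite powRr1.
rewrite -[leRHS]nE ler_wpM2l ?powR_ge0//.
have JE : J%:R = (J ^ 4)%:R `^ (1 / 4) :> R.
  rewrite natrX -powR_mulrn// -powRrM.
  have -> : 4%:R * (1 / 4) = 1 :> R by field.
  by rewrite powRr1.
by rewrite JE ge0_ler_powR ?nnegrE ?ler_nat// divr_ge0.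
Qed.

Theorem theorem3 (R : realType) (n : nat) (hn : (0 < n)%N) :
  exists (P : seq (pt2 R)) (f : pt2 R -> nat) (L : R),
    [/\ uniq P /\ size P = n, C_dense 4 P, stacking_order P f,
        ((fun e : R => vis (map (scale e) P) (fun x => f (scale e^-1 x)))
          @ 0^'+ --> L)
      & (n%:R) `^ (3 / 4) <= L].
Proof.
have [J Jn] := exists_nat_root 4 n isT; have /andP[Jn1 Jn2] := Jn.
have J0 : (0 < J)%N.
  by case: J Jn2 {Jn Jn1} => //; rewrite exp1n ltnS leqn0 => /eqP n0; rewrite n0 in hn.
pose P := mkseq (layered_pt R J) n; pose f (p : pt2 R) := (index p P).+1.
have ptI : injective (layered_pt R J).
  move=> i i' ii'; apply/eqP; apply: contraTT (lexx (0 : R)) => /(layered_pt_separated R J).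
  by rewrite -ltNge ii' /pdist !subrr expr0n addr0 sqrtr0; exact: lt_le_trans.
have Pu : uniq P by exact: mkseq_uniq.
have Ps : size P = n by exact: size_mkseq.
have PP p : p \in P -> exists2 i, (i < n)%N & p = layered_pt R J i.
  by move=> /mapP[i]; rewrite mem_iota => i_n ->; exists i.
have fE i : (i < n)%N -> f (layered_pt R J i) = i.+1.
  move=> i_n; rewrite /f -[X in index X _](nth_mkseq (0, 0) _ i_n).
  by rewrite index_uniq ?Ps.
have c0 : 0 <= (J%:R)^-1 :> R by rewrite invr_ge0.
have [p /PP[i i_n ->]|L [VL LE]] := @vis_limit_ge R P f _ c0.
  pose j := (i %% (J * J.+1) %/ J.+1)%N.
  have jJ : (j < J)%N by rewrite ltn_divLR// ltn_mod muln_gt0 J0.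
  (* The directions with cotangent between the decrements of the run of the point and of the next:
     these differ by [2 / J], which gives an angle of at least [1 / J]. *)
  exists (pi / 2 - atan (slope R J j.+1)), (pi / 2 - atan (slope R J j)).
  have pi2 := pi_ge2 R.
  split.
  - by have := atan_ltpi2 (slope R J j.+1); lra.
  - by have := atan_gtNpi2 (slope R J j); lra.
  - have /andP[s1 _] := slope_bounds R J j (ltnW jJ).
    have /andP[_ s2] := slope_bounds R J j.+1 jJ.
    have := atanB_ge R _ _ s1 (slope_le R J _ _ (leqnSn j)) s2.
    by rewrite [in X in X / 2]slopeS addrAC subrr add0r mulrAC divff// mul1r; lra.
  - move=> t tI q /PP[i' i'_n ->]; rewrite !fE// ltnS => ii'.
    exact: layered_pt_extreme.
exists P, f, L; split=> //.
- move=> _ _ _ _ /PP[i i_n ->] /PP[i' i'_n ->] /PP[k k_n ->] /PP[k' k'_n ->] kk.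
  rewrite Ps (le_trans (layered_pt_diam R J n i i' J0 Jn i_n i'_n))//.
  rewrite ler_peMr ?mulr_ge0// layered_pt_separated//.
  by apply: contraNneq kk => ->.
- split=> [p q pP qP [/(congr1 (nth (0, 0) P))]|p pP].
    by rewrite !nth_index.
  by rewrite /f /= index_mem.
- by apply: le_trans LE; rewrite Ps powR34_le.
Qed.
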